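(* Let $(X,\mathfrak A,P)$ and $(Y,\mathfrak B,Q)$ be probability spaces, let $\mathbb P=\{(\mathfrak A,P_y):y\in Y\}$ be a regular conditional probability on $\mathfrak A$ with respect to $Q$, and let $R$ be the skew product of $P$ and $Q$ on $\mathfrak A\otimes\mathfrak B$ determined by $\mathbb P$. Let $\Xi=\{\xi_y:y\in Y\}$ be a stochastic process defined on $(X,\mathfrak A,\mathbb P)$, also regarded as the function $\Xi(x,y)=\xi_y(x)$ on $X\times Y$. Then the following hold. (M1) If $\{\xi_y:y\in Y\}$ possesses a $\mathbb P$-equivalent measurable modification, then there exists a countably generated $\sigma$-algebra $\mathfrak C\subset\mathfrak A$ such that $\Xi$ is measurable with respect to $\mathfrak C\divideontimes_{\mathfrak A}\mathfrak B$. (M2) If there exists a $\sigma$-algebra $\mathfrak C\subset\mathfrak A$ such that $\mathfrak C$ is separable in the Fréchet–Nikodým pseudo-metric and $\Xi$ is measurable with respect to $\mathfrak C\divideontimes_{\mathfrak C}\mathfrak B$, then $\{\xi_y:y\in Y\}$ possesses a $\mathbb P$-equivalent measurable modification. Moreover, suppose that $\Xi$ is bounded, that $\mathfrak A$ contains a countably generated $\sigma$-algebra which is dense in $\mathfrak A$ in the Fréchet–Nikodým pseudo-metric with respect to $P$, that $\Xi$ is measurable with respect to $\mathfrak A\divideontimes_{\mathfrak A}\mathfrak B$, and that $\sigma_y\in\Lambda(\widehat{P_y})$ $(y\in Y)$ and a lifting $\pi:\mathcal L^\infty(R_{\divideontimes})\to\mathcal L^\infty(\widehat R)\subset\mathcal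 L^\infty(R_{\divideontimes})$ satisfy $[\pi(f)]^y=\sigma_y([\pi(f)]^y)$ for all $y\in Y$ and all $f\in\mathcal L^\infty(R_{\divideontimes})$. Then the measurable modification $\{\theta_y:y\in Y\}$ built from these liftings is given by $\theta_y=\sigma_y(\xi_y)$ for every $y\in Y$; that is, the process $\{\sigma_y(\xi_y):y\in Y\}$ is a $\mathbb P$-equivalent measurable modification of $\{\xi_y:y\in Y\}$.
   Context: For a measure space $(Z,\mathfrak Z,T)$, $(Z,\widehat{\mathfrak Z},\widehat T)$ denotes its completion, and $\mathfrak Z_0=\{A\in\mathfrak Z: T(A)=0\}$. $\mathcal L^\infty(T)$ is the collection of bounded $T$-measurable real functions. $\mathfrak A\otimes\mathfrak B$ is the product $\sigma$-algebra. For $E\subset X\times Y$ and $y\in Y$, $E^y=\{x\in X:(x,y)\in E\}$; for a function $f$ on $X\times Y$, $f^y$ (or $[f]^y$) is the function $x\mapsto f(x,y)$. Regular conditional probability and skew product: $\mathbb P=\{(\mathfrak A,P_y):y\in Y\}$ is a regular conditional probability (rcp) on $\mathfrak A$ with respect to $Q$ if each $P_y$ is a probability measure on $\mathfrak A$, for every $A\in\mathfrak A$ the function $y\mapsto P_y(A)$ is $\widehat Q$-measurable, and $\int_B P_y(A)\,dQ(y)=R(A\times B)$ for all $A\in\mathfrak A$, $B\in\mathfrak B$, where $R$ is a probability measure on $\mathfrak A\otimes\mathfrak B$ having $P$ and $Q$ as its marginals (so in particular $\int_Y P_y(A)\,dQ(y)=P(A)$). The measure $R$ is then given by $R(E)=\int_Y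 P_y(E^y)\,dQ(y)$ for $E\in\mathfrak A\otimes\mathfrak B$, and is called the skew product of $P$ and $Q$ determined by $\mathbb P$. Processes: a stochastic process $\{\xi_y:y\in Y\}$ on $(X,\mathfrak A,\mathbb P)$ is a family of real functions on $X$ such that each $\xi_y$ is measurable with respect to the $P_y$-completion of $\mathfrak A$. It is bounded if there is $\alpha\in(0,\infty)$ with $|\xi_y(x)|\le\alpha$ for all $(x,y)\in X\times Y$. Two processes $\{\xi_y\}$, $\{\theta_y\}$ are $\mathbb P$-equivalent if $\widehat{P_y}\{x\in X:\xi_y(x)\neq\theta_y(x)\}=0$ for every $y\in Y$. A process $\{\theta_y\}$ is measurable if $(x,y)\mapsto\theta_y(x)$ is $\widehat R$-measurable. A measurable process that is $\mathbb P$-equivalent to $\{\xi_y\}$ is called a ($\mathbb P$-equivalent) measurable modification of $\{\xi_y\}$. The $\sigma$-algebras: for a $\sigma$-algebra $\mathfrak D\subset\mathfrak A$ let $\mathcal M_{\mathfrak D}=\{E\subset X\times Y:\ \exists N\in\mathfrak B_0\ \forall y\notin N\ \ \widehat{P_y|_{\mathfrak D}}(E^y)=0\}$, where $\widehat{P_y|_{\mathfrak D}}$ is the completion of the restriction of $P_y$ to $\mathfrak D$ (so the condition says that $E^y$ is contained in a $P_y$-null set belonging to $\mathfrak D$). For $\sigma$-algebras $\mathfrak C\subset\mathfrak D\subset\mathfrak A$ let $\mathfrak C\divideontimes_{\mathfrak D}\mathfrak B=\{W\triangle N: W\in\mathfrak C\otimes\mathfrak B,\ N\in\mathcal M_{\mathfrak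 D}\}$. On $\mathfrak A\divideontimes_{\mathfrak A}\mathfrak B$ the complete measure $R_{\divideontimes}(V)=\int_Y\widehat{P_y}(V^y)\,d\widehat Q(y)$ is defined; it extends $\widehat R$, and its null sets are exactly the elements of $\mathcal M_{\mathfrak A}$. A sub-$\sigma$-algebra $\mathfrak C\subset\mathfrak A$ is separable in the Fréchet–Nikodým pseudo-metric if it is separable for $d(A,B)=P(A\triangle B)$. Liftings: for a complete probability measure $\mu$, a lifting on $\mathcal L^\infty(\mu)$ is a linear multiplicative positive map $\rho:\mathcal L^\infty(\mu)\to\mathcal L^\infty(\mu)$ with $\rho(1)=1$, $\rho(f)=f$ $\mu$-a.e., and $\rho(f)=\rho(g)$ whenever $f=g$ $\mu$-a.e.; $\Lambda(\mu)$ is the set of all liftings on $\mathcal L^\infty(\mu)$. Writing $\pi:\mathcal L^\infty(R_{\divideontimes})\to\mathcal L^\infty(\widehat R)$ means that $\pi$ is a lifting on $\mathcal L^\infty(R_{\divideontimes})$ all of whose values are $\widehat R$-measurable. *)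

(* Defs.v *)
From HB Require Import structures.
From mathcomp Require Import all_boot all_order all_algebra.
From mathcomp Require Import all_classical all_reals all_analysis.
From mathcomp Require Import measurable_realfun.
Set Implicit Arguments.
Unset Strict Implicit.
Unset Printing Implicit Defensive.
Import Order.TTheory GRing.Theory Num.Theory.
Import numFieldNormedType.Exports.
Local Open Scope classical_set_scope.
Local Open Scope ring_scope.

Section completion.
Context d (T : measurableType d) (R : realType).
Variable mu : {measure set T -> \bar R}.

Definition completion_display : {measure set T -> \bar R} -> measure_display.
Proof. exact. Qed.

Definition completion (m : {measure set T -> \bar R}) : Type := T.

Lemma completed_algebra0 : completed_algebra_gen mu set0.
Proof.
by exists set0 => //; exists set0; [exact: negligible_set0|rewrite setU0].
Qed.

Lemma completed_algebraC A :
  completed_algebra_gen mu A -> completed_algebra_gen mu (~` A).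
Proof.
move=> [B mB [N [F [mF F0 NF]] <-]].
exists (~` B `&` ~` F).
  by apply: measurableI; exact: measurableC.
exists (~` B `&` ~` N `&` F).
  by exists F; split => // x [].
rewrite setCU; apply/seteqP; split => [x [[nB nF]|[[]]//]|x [nB nN]].
  by split => // Nx; exact/nF/NF.
by have [Fx|nFx] := pselect (F x); [right|left].
Qed.

Lemma completed_algebra_bigcup (F : (set T)^nat) :
  (forall n, completed_algebra_gen mu (F n)) ->
  completed_algebra_gen mu (\bigcup_n F n).
Proof.
move=> mF.
have /choice[A /all_and2[mA /choice[N /all_and2[nN FE]]]] : forall n,
    exists A, measurable A /\
      exists N, mu.-negligible N /\ A `|` N = F n.
  by move=> n; have [A mA [N nN <-]] := mF n; exists A; split=> //; exists N.
exists (\bigcup_k A k); first exact: bigcupT_measurable.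
exists (\bigcup_k N k); first exact: negligible_bigcup.
by rewrite -bigcupU; apply: eq_bigcup.
Qed.

HB.instance Definition _ := Pointed.on (completion mu).
HB.instance Definition _ := @isMeasurable.Build (completion_display mu)
  (completion mu) (completed_algebra_gen mu)
  completed_algebra0 completed_algebraC completed_algebra_bigcup.

(** The type ascription keeps the covers in the outer measure [mu]-measurable;
    without it they would range over the sets of the completion. *)
Definition completed : set (completion mu) -> \bar R :=
  ((mu : set T -> \bar R)^*)%mu.

Lemma sub_completion (A : set T) :
  measurable A -> measurable (A : set (completion mu)).
Proof.
by move=> mA; exists A => //; exists set0; [exact: negligible_set0|rewrite setU0].
Qed.

Lemma completedE (A : set T) : measurable A -> completed A = mu A.
Proof. exact: measurable_mu_extE. Qed.

Lemma completion_caratheodory (A : set (completion mu)) : measurable A ->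
  ((mu^*)%mu).-cara.-measurable A.
Proof.
move=> [B mB [N [F [mF F0 NF]] <-]]; apply: measurableU.
  by apply: sub_caratheodory; exact: sub_sigma_algebra.
apply: measure_is_complete_caratheodory; exists F; split => //.
  by apply: sub_caratheodory; exact: sub_sigma_algebra.
by rewrite -F0; exact: measurable_mu_extE.
Qed.

Let completed0 : completed set0 = 0%E.
Proof. exact: outer_measure0. Qed.

Let completed_ge0 A : (0 <= completed A)%E.
Proof. exact: outer_measure_ge0. Qed.

Let completed_sigma_additive : semi_sigma_additive completed.
Proof.
move=> F mF tF mUF; apply: caratheodory_measure_sigma_additive => //.
- by move=> i; exact: completion_caratheodory.
- exact: completion_caratheodory.
Qed.

HB.instance Definition _ := isMeasure.Build _ _ _ completed
  completed0 completed_ge0 completed_sigma_additive.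

Lemma negligible_completed (A : set T) :
  mu.-negligible A -> completed.-negligible A.
Proof.
move=> [F [mF F0 AF]]; exists F; split => //; first exact: sub_completion.
by rewrite -F0; exact: completedE.
Qed.

Lemma completed_negligible (A : set (completion mu)) :
  completed.-negligible A -> mu.-negligible A.
Proof.
move=> [_ [[B mB [N [F [mF F0 NF]] <-]] BN0 AB]].
exists (B `|` F); split; first exact: measurableU.
  have B0 : mu B = 0%E.
    apply/eqP; rewrite -measure_le0 -BN0 -[leLHS](completedE mB).
    by apply: le_outer_measure; exact: subsetUl.
  exact: null_set_setU.
by move=> x /AB[Bx|/NF Fx]; [left|right].
Qed.

Lemma completed_complete : measure_is_complete completed.
Proof.
move=> A /completed_negligible nA; exists set0 => //.
by exists A => //; rewrite set0U.
Qed.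

End completion.
Arguments completed {d T R} mu _.

Section completed_probability.
Context d (T : measurableType d) (R : realType) (mu : probability T R).

Let completed_setT : completed mu [set: T] = 1%E.
Proof. by rewrite -(probability_setT mu); exact: completedE. Qed.

HB.instance Definition _ :=
  Measure_isProbability.Build _ _ _ (completed mu) completed_setT.

End completed_probability.

Section completed_setY.
Context d (T : measurableType d) (R : realType) (mu : {measure set T -> \bar R}).

Lemma measurable_completed_setY (A N : set T) : measurable A ->
  mu.-negligible N -> measurable (A `+` N : set (completion mu)).
Proof.
move=> /(sub_completion mu) mA /negligible_completed/completed_complete mN.
by rewrite setY_def; apply: measurableU; exact: measurableD.
Qed.

Lemma completed_setY (A N : set T) : measurable A -> mu.-negligible N ->
  completed mu (A `+` N) = mu A.
Proof.
move=> mA [F [mF F0 NF]]; rewrite -completedE//; apply/eqP; rewrite eq_le.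
have nF : completed mu F = 0%E by rewrite -F0; exact: completedE.
have AF B : (completed mu (B `|` F) <= completed mu B)%E.
  by rewrite -[leRHS]adde0 -nF; exact: outer_measureU2.
apply/andP; split.
  apply: le_trans (AF A); apply: le_outer_measure => x.
  by rewrite setY_def => -[[Ax _]|[/NF Fx _]]; [left|right].
apply: le_trans (AF (A `+` N)); apply: le_outer_measure => x Ax.
have [Nx|nNx] := pselect (N x); first by right; exact: NF.
by left; rewrite setY_def; left.
Qed.

End completed_setY.

Section liftings.
Context d (T : measurableType d) (R : realType).

Definition Linfty (mu : probability T R) : set (T -> R) :=
  [set f : T -> R |
    measurable_fun [set: T] f /\ exists M : R, forall x, `|f x| <= M].

(** A map of [Linfty mu] into itself is represented by a total map on [T -> R]
    whose values outside [Linfty mu] are irrelevant. *)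
Record is_lifting (mu : probability T R) (rho : (T -> R) -> T -> R) : Prop := {
  lifting_Linfty : forall f, Linfty mu f -> Linfty mu (rho f) ;
  lifting_linear : forall (a b : R) f g, Linfty mu f -> Linfty mu g ->
    rho (fun x => a * f x + b * g x) = (fun x => a * rho f x + b * rho g x) ;
  lifting_mul : forall f g, Linfty mu f -> Linfty mu g ->
    rho (fun x => f x * g x) = (fun x => rho f x * rho g x) ;
  lifting_ge0 : forall f, Linfty mu f ->
    (forall x, 0 <= f x) -> forall x, 0 <= rho f x ;
  lifting1 : rho (cst 1) = cst 1 ;
  lifting_ae : forall f, Linfty mu f -> \forall x \ae mu, rho f x = f x ;
  lifting_ae_eq : forall f g, Linfty mu f -> Linfty mu g ->
    (\forall x \ae mu, f x = g x) -> rho f = rho g }.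

Definition Lambda (mu : probability T R) : set ((T -> R) -> T -> R) :=
  [set rho | is_lifting mu rho].

End liftings.

Section subalgebras.
Context d (T : measurableType d) (R : realType).
Implicit Types C G : set (set T).

Definition sub_sigma_alg C := sigma_algebra [set: T] C /\ C `<=` measurable.

Definition countably_generated C :=
  exists2 G, countable G & C = <<s G >>.

Definition FN_dense (P : probability T R) G C :=
  forall A (e : R), C A -> 0 < e ->
    exists2 B, G B & (P (A `+` B) < e%:E)%E.

Definition FN_separable (P : probability T R) C :=
  exists G, [/\ countable G, G `<=` C & FN_dense P G C].

End subalgebras.

Definition measurable_wrt (T : Type) (R : realType) (G : set (set T))
    (f : T -> R) :=
  forall U : set R, measurable U -> G (f @^-1` U).

Section star.
Context dX dY (X : measurableType dX) (Y : measurableType dY) (R : realType).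
Variables (Pk : Y -> probability X R) (Q : probability Y R).

Definition prod_alg (C : set (set X)) : set (set (X * Y)) :=
  <<s [set A `*` B | A in C & B in (measurable : set (set Y))] >>.

(** [ysection E y] is null for the completion of the restriction of [Pk y] to
    [D]: it is covered by a null set that belongs to [D]. *)
Definition null_sections (D : set (set X)) : set (set (X * Y)) :=
  [set E | exists N : set Y, [/\ measurable N, Q N = 0%E &
    forall y, ~ N y ->
      exists A : set X, [/\ D A, Pk y A = 0%E & ysection E y `<=` A]]].

Definition star (C D : set (set X)) : set (set (X * Y)) :=
  [set W `+` N | W in prod_alg C & N in null_sections D].

Lemma null_sectionsS D E F :
  E `<=` F -> null_sections D F -> null_sections D E.
Proof.
move=> EF [N [mN N0 NF]]; exists N; split => // y /NF[A [DA A0 FA]].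
exists A; split => //; apply: subset_trans FA.
by move=> x /ysectionP /EF ?; exact/ysectionP.
Qed.

Lemma null_sections_bigcup D (E : (set (X * Y))^nat) : sub_sigma_alg D ->
  (forall n, null_sections D (E n)) -> null_sections D (\bigcup_n E n).
Proof.
move=> [[_ _ DU] Dm] /choice[N /all_and3[mN N0 NE]].
exists (\bigcup_n N n); split.
- exact: bigcupT_measurable.
- apply/negligibleP; first exact: bigcupT_measurable.
  by apply: negligible_bigcup => n; apply/negligibleP; [exact: mN|exact: N0].
- move=> y nN.
  have /choice[A /all_and3[DA A0 EA]] : forall n,
      exists A, [/\ D A, Pk y A = 0%E & ysection (E n) y `<=` A].
    by move=> n; apply: NE => Ny; apply: nN; exists n.
  exists (\bigcup_n A n); split; first exact: DU.
    apply/negligibleP; first by apply: bigcupT_measurable => n; exact: Dm.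
    by apply: negligible_bigcup => n; apply/negligibleP; [exact: Dm|exact: A0].
  by move=> x /ysectionP[n _ Enx]; exists n => //; apply/EA/ysectionP.
Qed.

Lemma null_sections0 D : sub_sigma_alg D -> null_sections D set0.
Proof.
move=> [[D0 _ _] _]; exists set0; split => // y _.
by exists set0; split => //; rewrite ysection0.
Qed.

Lemma star0 C D : sub_sigma_alg D -> star C D set0.
Proof.
move=> hD; exists set0; first exact: sigma_algebra0.
by exists set0; [exact: null_sections0|rewrite setYK].
Qed.

Lemma starC C D V : star C D V -> star C D (~` V).
Proof.
move=> [W mW [N nN <-]]; exists (~` W).
  by rewrite -setTD; exact: sigma_algebraCD.
by exists N => //; rewrite -(setTYC W) -(setTYC (W `+` N)) setYA.
Qed.

Lemma star_bigcup C D (V : (set (X * Y))^nat) : sub_sigma_alg D ->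
  (forall n, star C D (V n)) -> star C D (\bigcup_n V n).
Proof.
move=> hD mV.
have /choice[W /all_and2[mW /choice[N /all_and2[nN VE]]]] : forall n,
    exists W, prod_alg C W /\ exists N, null_sections D N /\ W `+` N = V n.
  by move=> n; have [W mW [N nN <-]] := mV n; exists W; split => //; exists N.
exists (\bigcup_n W n); first exact: sigma_algebra_bigcup.
exists ((\bigcup_n W n) `+` (\bigcup_n V n)); last first.
  by rewrite setYA setYK set0Y.
apply: null_sectionsS (null_sections_bigcup hD nN).
move=> x; rewrite setY_def => -[[[n _ Wn] nV]|[[n _ Vn] nW]]; exists n => //.
  apply: contrapT => nNn; apply: nV; exists n => //.
  by rewrite -VE setY_def; left.
move: Vn; rewrite -VE setY_def => -[[Wn _]|[]//].
by exfalso; apply: nW; exists n.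
Qed.

Definition star_display : (Y -> probability X R) -> probability Y R ->
  measure_display.
Proof. exact. Qed.

Definition star_type (Pk : Y -> probability X R) (Q : probability Y R) : Type :=
  (X * Y)%type.

Lemma sub_sigma_algT d (T : measurableType d) :
  sub_sigma_alg (@measurable _ T).
Proof.
split=> //; split => //; last by move=> F mF; exact: bigcupT_measurable.
by move=> A mA; rewrite setTD; exact: measurableC.
Qed.

HB.instance Definition _ := Pointed.on (star_type Pk Q).
HB.instance Definition _ := @isMeasurable.Build (star_display Pk Q)
  (star_type Pk Q) (star measurable measurable)
  (star0 _ (sub_sigma_algT X)) (@starC _ _)
  (fun V => @star_bigcup _ _ V (sub_sigma_algT X)).

End star.
Arguments null_sections {dX dY X Y R} Pk Q D.
Arguments star {dX dY X Y R} Pk Q C D.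

Section rcp.
Context dX dY (X : measurableType dX) (Y : measurableType dY) (R : realType).

(** [Rm] is uniquely determined by the kernel: it is the skew product of [P]
    and [Q]. *)
Record rcp (P : probability X R) (Q : probability Y R)
    (Rm : probability (X * Y)%type R) := Rcp {
  rcp_ker :> Y -> probability X R ;
  rcp_measurable : forall A : set X, measurable A ->
    measurable_fun [set: completion Q] (fun y => rcp_ker y A) ;
  rcp_integral : forall (A : set X) (B : set Y), measurable A -> measurable B ->
    (\int[completed Q]_(y in B) rcp_ker y A)%E = Rm (A `*` B) ;
  rcp_marginal1 : forall A : set X, measurable A -> Rm (A `*` [set: Y]) = P A ;
  rcp_marginal2 : forall B : set Y, measurable B -> Rm ([set: X] `*` B) = Q B }.

Context (P : probability X R) (Q : probability Y R)
  (Rm : probability (X * Y)%type R) (PP : rcp P Q Rm).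

Definition Rstar : set (star_type PP Q) -> \bar R :=
  fun V => (\int[completed Q]_y completed (PP y) (ysection V y))%E.

Let sect (W : set (X * Y)) (y : Y) := PP y (ysection W y).

Let measurable_sect (W : set (X * Y)) : measurable W ->
  measurable_fun [set: completion Q] (sect W : completion Q -> _).
Proof.
pose H : set_system (X * Y) := [set W |
  measurable_fun [set: completion Q] (sect W : completion Q -> _)].
have mys W' (y : Y) : measurable W' -> measurable (ysection W' y : set X).
  exact: measurable_ysection.
move=> mW; rewrite -/(H W); move: W mW; rewrite measurable_prod_measurableType.
apply: (@dynkin_induction _ _
  [set A `*` B | A in measurable & B in measurable] H); rewrite /H /=.
- exact: measurable_prod_measurableType.
- move=> _ _ [A mA [B mB <-]] [A' mA' [B' mB' <-]].
  exists (A `&` A'); first exact: measurableI.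
  by exists (B `&` B'); [exact: measurableI|rewrite setXI].
- rewrite (_ : sect _ = cst 1%E); first exact: measurable_cst.
  apply/funext => y; rewrite -(probability_setT (PP y)); congr (PP y _).
  by apply/seteqP; split => // x _; exact/ysectionP.
- move=> _ [A mA [B mB <-]] /=.
  rewrite (_ : sect _ = (fun y => PP y A * (\1_B y)%:E)%E).
    apply: emeasurable_funM; first exact: rcp_measurable.
    by apply/measurable_EFinP/measurable_indic; exact: sub_completion.
  apply/funext => y; rewrite indicE /sect; have [yB|yB] := boolP (y \in B).
    by rewrite in_ysectionX// mule1.
  by rewrite notin_ysectionX// measure0 mule0.
- move=> W mW IH /=.
  rewrite (_ : sect _ = (fun y => 1 - sect W y)%E).
    by apply: emeasurable_funB => //; exact: measurable_cst.
  apply/funext => y; rewrite /sect.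
  have -> : ysection (~` W) y = ~` ysection W y by rewrite !ysectionE.
  by rewrite probability_setC//; exact: mys.
- move=> F mF tF IH /=.
  rewrite (_ : sect _ = (fun y => \sum_(n <oo) sect (F n) y)%E).
    by apply: ge0_emeasurable_sum.
  apply/funext => y; rewrite /sect ysection_bigcup measure_bigcup//=.
  + by apply: eq_eseriesl => n; rewrite in_setT.
  + by move=> n _; exact: mys.
  + exact: trivIset_ysection.
Qed.

Lemma measurable_rcp_ysection (W : set (X * Y)) : measurable W ->
  measurable_fun [set: completion Q] (fun y => PP y (ysection W y)).
Proof. exact: measurable_sect. Qed.

Let aeQ := ae_filter_ringOfSetsType (completed Q).

Lemma star_ysection (V : set (star_type PP Q)) : measurable V ->
  exists2 W : set (X * Y), measurable W & \forall y \ae completed Q,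
    measurable (ysection V y : set (completion (PP y))) /\
    completed (PP y) (ysection V y) = PP y (ysection W y).
Proof.
move=> [W mW [E [N [mN N0 NE]] <-]].
have {}mW : measurable W by rewrite measurable_prod_measurableType.
exists W => //.
suff : \forall y \ae completed Q, ~ N y.
  apply: (@filterS _ _ aeQ) => y /NE[A [mA A0 EA]].
  have mWy : measurable (ysection W y) by exact: measurable_ysection.
  have -> : ysection (W `+` E) y = ysection W y `+` ysection E y.
    by rewrite !ysectionE.
  have nE : (PP y).-negligible (ysection E y) by exists A.
  by split; [exact: measurable_completed_setY|exact: completed_setY].
suff : (completed Q).-negligible (~` (~` N)) by [].
by rewrite setCK; apply: negligible_completed; exists N; split.
Qed.

Lemma measurable_completed_ysection (V : set (star_type PP Q)) :
  measurable V ->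
  measurable_fun [set: completion Q]
    (fun y => completed (PP y) (ysection V y)).
Proof.
move=> /star_ysection[W mW VW].
apply: (ae_measurable_fun (@completed_complete _ _ _ Q) _
  (measurable_rcp_ysection mW)).
by apply: (@filterS _ _ aeQ) VW => y [_ ->].
Qed.

Let Rstar0 : Rstar set0 = 0%E.
Proof.
rewrite /Rstar integral0_eq// => y _.
by rewrite ysection0 measure0.
Qed.

Let Rstar_ge0 V : (0 <= Rstar V)%E.
Proof. by apply: integral_ge0 => y _; exact: measure_ge0. Qed.

Let Rstar_sigma_additive : semi_sigma_additive Rstar.
Proof.
move=> V mV tV mUV; rewrite [X in _ --> X](_ : _ = (\int[completed Q]_y
  (\sum_(n <oo) completed (PP y) (ysection (V n) y)))%E); last first.
  apply: ge0_ae_eq_integral => //.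
  - exact: measurable_completed_ysection.
  - apply: ge0_emeasurable_sum => // n _.
    exact: measurable_completed_ysection.
  - by move=> y _; exact: nneseries_ge0.
  - have : \forall y \ae completed Q, forall n,
        measurable (ysection (V n) y : set (completion (PP y))).
      apply: ae_foralln => n; have [W mW] := star_ysection (mV n).
      by apply: (@filterS _ _ aeQ) => y [].
    apply: (@filterS _ _ aeQ) => y mVy _.
    rewrite ysection_bigcup measure_bigcup//=.
    + by apply: eq_eseriesl => n; rewrite in_setT.
    + exact: trivIset_ysection.
apply/cvg_closeP; split.
  by apply: is_cvg_nneseries => n _ _; exact: Rstar_ge0.
rewrite closeE// integral_nneseries// => n.
exact: measurable_completed_ysection.
Qed.

HB.instance Definition _ := isMeasure.Build _ _ _ Rstar
  Rstar0 Rstar_ge0 Rstar_sigma_additive.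

Let Rstar_setT : Rstar [set: star_type PP Q] = 1%E.
Proof.
rewrite /Rstar (eq_integral (cst 1%E)) => [|y _].
  by rewrite integral_cst// mul1e; exact: probability_setT.
rewrite (_ : ysection _ _ = [set: X]); last first.
  by apply/seteqP; split => // x _; exact/ysectionP.
exact: (probability_setT (completed (PP y))).
Qed.

HB.instance Definition _ := Measure_isProbability.Build _ _ _ Rstar Rstar_setT.

End rcp.
Arguments Rstar {dX dY X Y R P Q Rm} PP _.

Section processes.
Context dX dY (X : measurableType dX) (Y : measurableType dY) (R : realType).
Context (P : probability X R) (Q : probability Y R)
  (Rm : probability (X * Y)%type R) (PP : rcp P Q Rm).
Implicit Types xi theta : Y -> X -> R.

Definition process xi :=
  forall y, measurable_fun [set: completion (PP y)] (xi y).

Definition prod_fun xi : X * Y -> R := fun z => xi z.2 z.1.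

Definition bounded_process xi :=
  exists2 alpha : R, 0 < alpha & forall x y, `|xi y x| <= alpha.

Definition equivalent xi theta :=
  forall y, completed (PP y) [set x | xi y x <> theta y x] = 0%E.

Definition measurable_process theta :=
  measurable_fun [set: completion Rm] (prod_fun theta).

Definition measurable_modification xi theta :=
  [/\ process theta, measurable_process theta & equivalent xi theta].

End processes.
Arguments prod_fun {dX dY X Y R} xi _.
Arguments bounded_process {dX dY X Y R} xi.

(* Main.v *)
Require Import Defs.
From HB Require Import structures.
From mathcomp Require Import all_boot all_order all_algebra.
From mathcomp Require Import all_classical all_reals all_analysis.
From mathcomp Require Import measurable_realfun.
Import Order.TTheory GRing.Theory Num.Theory.
Local Open Scope classical_set_scope.
Local Open Scope ring_scope.

(** The link between the complete measure on the star sigma-algebra and the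
    kernel is that a set negligible for [Rstar PP] has [PP y]-negligible
    sections for all [y] outside a measurable [Q]-null set
    ([Rstar_negligible_sections]): its measure is the integral of the measures
    of its sections. Since [Rstar PP] agrees with the skew product [Rm] on the
    product sigma-algebra ([RstarE]), the same holds for [Rm]-negligible sets.
    In the other direction, the values of a process on a measurable [Q]-null
    set of parameters do not affect its measurability for the completion of
    [Rm] ([measurable_eq_off_null]).

    A real function is determined by its preimages of the rays with rational
    endpoint. For a measurable modification [theta], each of these countably
    many preimages is, up to an [Rm]-negligible set, in the product
    sigma-algebra, hence generated by countably many rectangles
    ([measurable_countably_generated]). The sides in [X] of all these
    rectangles generate the required [C]; passing from [theta] to [xi] changes
    each section only by a null set.

    Conversely, star measurability of the process as a function on [X * Y]
    provides a product measurable function [g] whose section at [y] is almost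
    everywhere equal to [xi y], except for [y] in a null set [N]
    ([star_measurable_version]). Taking [g] off [N] and the original [xi y] for
    [y] in [N] makes the two processes equivalent at every [y], while
    measurability survives because [N] is null.

    Given the liftings, the lifting [pi] moves the process only on a set that
    is null for [Rstar PP], so for almost every [y] the section of its image is
    almost everywhere equal to [xi y]. That section is fixed by [sigma y], and
    [sigma y] does not distinguish functions equal almost everywhere, so it is
    [sigma y (xi y)]. Hence [sigma y (xi y)] differs from the sections of one
    measurable function only on a null set of parameters. *)

(** * Rational rays and countably generated sigma-algebras *)

Lemma bigcup_rat_itvoy (R : realType) (r : R) :
  \bigcup_(q : rat) (if r < ratr q then `]ratr q, +oo[%classic else set0) =
  `]r, +oo[%classic.
Proof.
apply/seteqP; split => x /=.
  move=> [q _]; case: ifPn => // rq; rewrite /= !in_itv /= !andbT.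
  exact: lt_trans.
rewrite in_itv /= andbT => /rat_in_itvoo[q]; rewrite in_itv /= => /andP[rq qx].
by exists q => //; rewrite rq /= in_itv /= qx.
Qed.

(** Countably many preimages control measurability; only this countability lets
    a countably generated sigma-algebra be extracted from a single function. *)
Lemma measurable_wrt_rat_rays {T : pointedType} {R : realType}
    (S : set (set T)) (f : T -> R) : sigma_algebra [set: T] S ->
  (forall q : rat, S (f @^-1` `]ratr q, +oo[)) -> measurable_wrt S f.
Proof.
move=> sS Sf U mU.
suff : measurable_fun [set: g_sigma_algebraType S] f.
  move=> /(_ measurableT _ mU); rewrite setTI.
  by rewrite /measurable /= sigma_algebra_id.
apply: (measurability _ (RGenOInfty.measurableE R)) => _ [_ [r ->] <-].
rewrite setTI -bigcup_rat_itvoy preimage_bigcup.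
apply: bigcupT_measurable_rat => q; case: ifPn => _.
  exact: sub_sigma_algebra.
by rewrite preimage_set0; exact: measurable0.
Qed.

Lemma prod_algS {dX dY} {X : measurableType dX} {Y : measurableType dY}
    (C D : set (set X)) : C `<=` D -> prod_alg (Y := Y) C `<=` prod_alg D.
Proof.
move=> CD; apply: sub_sigma_algebra2 => _ [A CA [B mB <-]].
by exists A; [exact: CD|exists B].
Qed.

(** The sets with this property form a sigma-algebra, because a countable union
    of countable families of sides is countable. *)
Lemma measurable_countably_generated {dX dY} {X : measurableType dX}
    {Y : measurableType dY} {E : set (X * Y)} : measurable E ->
  exists G : set (set X),
    [/\ countable G, G `<=` measurable & prod_alg <<s G >> E].
Proof.
pose H : set (set (X * Y)) := [set E | exists G : set (set X),
  [/\ countable G, G `<=` measurable & prod_alg <<s G >> E]].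
rewrite measurable_prod_measurableType -/(H E); move: E; apply: smallest_sub.
- split.
  + by exists set0; split => //; exact: sigma_algebra0.
  + move=> E [G [cG mG GE]]; exists G; split => //.
    exact: sigma_algebraCD.
  + move=> F /choice[G /all_and3[cG mG GF]]; exists (\bigcup_n G n); split.
    * by apply: bigcup_countable => // n _; exact: cG.
    * by move=> A [n _]; exact: mG.
    * apply: sigma_algebra_bigcup => n; move: (GF n); apply: prod_algS.
      by apply: sub_sigma_algebra2; exact: bigcup_sup.
- move=> _ [A mA [B mB <-]]; exists [set A]; split.
  + exact: countable1.
  + by move=> _ ->.
  + apply: sub_sigma_algebra; exists A; first exact: sub_sigma_algebra.
    by exists B.
Qed.

(** * Functions measurable for a star sigma-algebra *)

Section star_functions.
Context {dX dY} {X : measurableType dX} {Y : measurableType dY} {R : realType}.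
Variables (Pk : Y -> probability X R) (Q : probability Y R).

Lemma sigma_algebra_star (C D : set (set X)) :
  sub_sigma_alg D -> sigma_algebra [set: X * Y] (star Pk Q C D).
Proof.
move=> sD; split; first exact: star0.
  by move=> V CV; rewrite setTD; exact: starC.
by move=> F CF; exact: star_bigcup.
Qed.

Lemma null_sectionsU {D : set (set X)} {E F : set (X * Y)} : sub_sigma_alg D ->
  null_sections Pk Q D E -> null_sections Pk Q D F ->
  null_sections Pk Q D (E `|` F).
Proof.
move=> sD nE nF; rewrite -bigcup2E; apply: null_sections_bigcup => //.
by move=> [|[|n]] //=; exact: null_sections0.
Qed.

Lemma prod_alg_measurable (C : set (set X)) : C `<=` measurable ->
  prod_alg (Y := Y) C `<=` measurable.
Proof. by rewrite measurable_prod_measurableType; exact: prod_algS. Qed.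

(** If [W q] is a product measurable version of the set where [f] exceeds the
    rational [q], then [f] is recovered at [z], off the exceptional sets, as the
    supremum of the [q] such that [W q] contains [z]. *)
Lemma star_measurable_version (C D : set (set X)) (f : X * Y -> R) :
    sub_sigma_alg C -> sub_sigma_alg D -> measurable_wrt (star Pk Q C D) f ->
  exists2 g : X * Y -> R, measurable_fun [set: X * Y] g &
    null_sections Pk Q D [set z | f z <> g z].
Proof.
move=> [_ Cm] sD mf.
have /choice[W /all_and2[mW /choice[N /all_and2[nN WN]]]] : forall q : rat,
    exists W, measurable W /\ exists N, null_sections Pk Q D N /\
      W `+` N = f @^-1` `]ratr q, +oo[.
  move=> q; have [W mW [N nN WN]] := mf `]ratr q, +oo[%classic ltac:(by []).
  by exists W; split; [exact: prod_alg_measurable mW|exists N].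
(* Extended real values: the supremum may be infinite on the exceptional
   sets, where [fine] makes it an arbitrary real number. *)
pose h z := ereal_sup [set (ratr q : R)%:E | q in [set q | W q z]].
have mh : measurable_fun [set: X * Y] h.
  apply: (measurability _ (ErealGenOInfty.measurableE R)) => _ [_ [r ->] <-].
  rewrite setTI [X in measurable X](_ : _ =
    \bigcup_(q : rat) (if r < ratr q then W q else set0)).
    by apply: bigcupT_measurable_rat => q; case: ifP.
  apply/seteqP; split => z /=; rewrite in_itv /= andbT.
    move=> /ereal_sup_gtP[_ [q Wqz <-]]; rewrite lte_fin => rq.
    by exists q => //; rewrite rq.
  move=> [q _]; case: ifPn => // rq Wqz; apply/ereal_sup_gtP.
  by exists (ratr q)%:E; [exists q|rewrite lte_fin].
exists (fine \o h).
  by apply: measurableT_comp mh; exact: fine_measurable.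
have nU : null_sections Pk Q D (\bigcup_(q : rat) N q).
  (* The union over the rationals is re-indexed by the naturals. *)
  pose N' n := if @unpickle rat n is Some q then N q else set0.
  have : null_sections Pk Q D (\bigcup_n N' n).
    apply: null_sections_bigcup => // n; rewrite /N'.
    by case: unpickle => [q|]; [exact: nN|exact: null_sections0].
  apply: null_sectionsS => z [q _ Nqz].
  by exists (pickle q); [|rewrite /N' pickleK].
apply: null_sectionsS nU => z fgz; apply: contrapT => nz; apply: fgz.
(* Off all the sets [N q], membership in [W q] is exactly [q < f z]. *)
have Wz q : W q z <-> ratr q < f z.
  have -> : W q z <-> (f @^-1` `]ratr q, +oo[) z.
    rewrite -WN setY_def; split => [Wqz|[[]//|[Nqz _]]].
      by left; split => // Nqz; apply: nz; exists q.
    by exfalso; apply: nz; exists q.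
  by rewrite /= in_itv /= andbT.
suff hfz : h z = (f z)%:E by rewrite /= hfz.
apply/eqP; rewrite eq_le; apply/andP; split.
  by apply: ge_ereal_sup => _ [q /Wz qf <-]; rewrite lee_fin ltW.
rewrite leNgt; apply/negP => hz.
have [q] : exists q : rat, (h z < (ratr q)%:E < (f z)%:E)%E.
  have [r hr rf] : exists2 r : R, (h z <= r%:E)%E & r < f z.
    case: (h z) hz => [r rf| |_]; last 2 first.
    - by [].
    - by exists (f z - 1); [exact: leNye|rewrite ltrBlDr ltrDl].
    by exists r.
  have [q] := rat_in_itvoo rf; rewrite in_itv /= => /andP[rq qf].
  by exists q; rewrite !lte_fin qf andbT (le_lt_trans hr)// lte_fin.
rewrite lte_fin => /andP[hq /Wz Wqz].
by move: hq; rewrite ltNge => /negP; apply; apply: ereal_sup_ubound; exists q.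
Qed.

End star_functions.

(** * Null sets of the skew product *)

Section skew_product.
Context {dX dY} {X : measurableType dX} {Y : measurableType dY} {R : realType}.
Context {P : probability X R} {Q : probability Y R}
  {Rm : probability (X * Y)%type R} (PP : rcp P Q Rm).

Lemma measurable_star {W : set (X * Y)} :
  measurable W -> measurable (W : set (star_type PP Q)).
Proof.
move=> mW; exists W; first by rewrite /prod_alg -measurable_prod_measurableType.
by exists set0; [exact/null_sections0/sub_sigma_algT|rewrite setY0].
Qed.

(** Both sides are probability measures on the product sigma-algebra that agree
    on rectangles, by the defining property of the kernel. *)
Lemma RstarE (W : set (X * Y)) : measurable W -> Rstar PP W = Rm W.
Proof.
move=> mW; have := mW; rewrite measurable_prod_measurableType.
apply: (@dynkin_induction _ _
  [set A `*` B | A in measurable & B in measurable]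
  [set W | Rstar PP W = Rm W] _ _ _ _ _ _ W); rewrite ?/=.
- exact: measurable_prod_measurableType.
- move=> _ _ [A mA [B mB <-]] [A' mA' [B' mB' <-]].
  exists (A `&` A'); first exact: measurableI.
  by exists (B `&` B'); [exact: measurableI|rewrite setXI].
- by rewrite (probability_setT Rm); exact: (probability_setT (Rstar PP)).
- move=> _ [A mA [B mB <-]] /=.
  rewrite -(rcp_integral PP mA mB) integral_mkcond; apply: eq_integral => y _.
  rewrite patchE; case: ifPn => yB.
    by rewrite in_ysectionX// completedE.
  by rewrite notin_ysectionX// measure0.
- move=> E mE /= RE; rewrite (probability_setC Rm)// -RE.
  exact: (probability_setC (Rstar PP) (measurable_star mE)).
- move=> F mF tF RF.
  rewrite (measure_bigcup Rm)// (measure_bigcup (Rstar PP))//.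
    by apply: eq_eseriesr => n _; exact: RF.
  by move=> n _; exact: measurable_star.
Qed.

(** A nonnegative function with zero integral vanishes almost everywhere; here
    the function is the measure of the section. *)
Lemma Rstar_negligible_sections {E : set (X * Y)} :
  (Rstar PP).-negligible E -> null_sections PP Q measurable E.
Proof.
move=> [V [mV V0 EV]]; apply: null_sectionsS EV _.
have [W _ VW] := star_ysection mV.
have V0ae : \forall y \ae completed Q, completed (PP y) (ysection V y) = 0%E.
  have mVy := measurable_completed_ysection mV.
  have /(ae_eq_integral_abs _ measurableT mVy) :
      (\int[completed Q]_y `|completed (PP y) (ysection V y)| = 0)%E.
    by rewrite -[RHS]V0; apply: eq_integral => y _; rewrite gee0_abs.
  by apply: (@filterS _ _ (ae_filter_ringOfSetsType (completed Q))) => y /(_ I).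
have /completed_negligible[N [mN N0 VN]] :
    (completed Q).-negligible [set y | ~ (PP y).-negligible (ysection V y)].
  have aeV := @filterI _ _ (ae_filter_ringOfSetsType (completed Q)) _ _ VW V0ae.
  apply: negligibleS aeV => y /= nVy [[mVy _] Vy0]; apply: nVy.
  by apply: completed_negligible; exists (ysection V y); split.
exists N; split => // y nNy.
have [A [mA A0 VA]] : (PP y).-negligible (ysection V y).
  by apply: contrapT => /VN.
by exists A.
Qed.

Lemma skew_negligible_sections {E : set (X * Y)} :
  Rm.-negligible E -> null_sections PP Q measurable E.
Proof.
move=> [F [mF F0 EF]]; apply: Rstar_negligible_sections; exists F; split => //.
- exact: measurable_star.
- by rewrite -F0; exact: RstarE.
Qed.

(** [X * N] is null because [Q] is the second marginal of [Rm], and a complete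
    measure does not see changes on a null set. *)
Lemma measurable_eq_off_null (N : set Y) (f g : X * Y -> R) :
    measurable N -> Q N = 0%E -> (forall x y, ~ N y -> f (x, y) = g (x, y)) ->
  measurable_fun [set: completion Rm] (g : completion Rm -> R) ->
  measurable_fun [set: completion Rm] (f : completion Rm -> R).
Proof.
move=> mN N0 fg /measurable_EFinP mg; apply/measurable_EFinP.
apply: (ae_measurable_fun (@completed_complete _ _ _ Rm) _ mg).
apply: negligibleS (negligible_completed (A := [set: X] `*` N) _).
  move=> [x y] /= gf; split => //=; apply: contrapT => /(fg x) fgxy.
  by apply: gf => _; rewrite /= fgxy.
exists ([set: X] `*` N); split => //; first exact: measurableX.
exact: etrans (rcp_marginal2 PP mN) N0.
Qed.

Lemma completed_negligible_eq0 {d} {T : measurableType d}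
    (mu : {measure set T -> \bar R}) (A : set T) :
  mu.-negligible A -> completed mu A = 0%E.
Proof.
move=> /negligible_completed nA; apply/negligibleP => //.
exact: completed_complete.
Qed.

(** * Measurable modifications *)

(** [equivalent] speaks of an outer measure; measurability of both processes is
    what turns its vanishing into a null cover in the original sigma-algebra. *)
Lemma equivalent_negligible {xi theta : Y -> X -> R} :
  process PP xi -> process PP theta -> equivalent PP xi theta ->
  forall y, (PP y).-negligible [set x | xi y x <> theta y x].
Proof.
move=> hxi htheta xitheta y; apply: completed_negligible.
exists [set x | xi y x <> theta y x]; split; [|exact: xitheta|by []].
rewrite [X in measurable X](_ : _ =
    [set: completion (PP y)] `&` [set x | (xi y x)%:E != (theta y x)%:E]).
  by apply: measurable_neqe => //; apply/measurable_EFinP.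
rewrite setTI; apply/seteqP; split => x /= xt.
  by rewrite eqe; exact/eqP.
by apply/eqP; rewrite -eqe.
Qed.

Lemma measurable_modification_star (xi theta : Y -> X -> R) :
  process PP xi -> measurable_modification PP xi theta ->
  exists C : set (set X), [/\ sub_sigma_alg C, countably_generated C &
    measurable_wrt (star PP Q C measurable) (prod_fun xi)].
Proof.
move=> hxi [htheta mtheta xitheta].
have /choice[W /all_and2[mW Wtheta]] : forall q : rat,
    exists W : set (X * Y), measurable W /\ null_sections PP Q measurable
      (W `+` prod_fun theta @^-1` `]ratr q, +oo[).
  move=> q; have := mtheta measurableT `]ratr q, +oo[%classic ltac:(by []).
  rewrite setTI => -[B mB [N nN BN]]; exists B; split => //.
  rewrite -BN; apply: null_sectionsS (skew_negligible_sections nN).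
  move=> z; rewrite setY_def => -[[Bz nBNz]|[[Bz|//] nBz]]; exfalso.
    by apply: nBNz; left.
  exact: nBz.
have /choice[G /all_and3[cG mG GW]] :=
  fun q => measurable_countably_generated (mW q).
pose GU := \bigcup_q G q; have mGU : GU `<=` measurable.
  by move=> A [q _]; exact: mG.
exists <<s GU >>; split.
- split; first exact: smallest_sigma_algebra.
  by apply: smallest_sub => //; have [] := @sub_sigma_algT _ X.
- by exists GU => //; apply: bigcup_countable => // q _; exact: cG.
apply: measurable_wrt_rat_rays; first exact/sigma_algebra_star/sub_sigma_algT.
move=> q; exists (W q).
  move: (GW q); apply: prod_algS; apply: sub_sigma_algebra2.
  exact: bigcup_sup.
exists (W q `+` prod_fun xi @^-1` `]ratr q, +oo[); last first.
  by rewrite setYA setYK set0Y.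
have nxi : null_sections PP Q measurable
    [set z | prod_fun xi z <> prod_fun theta z].
  exists set0; split => // y _.
  have [A [mA A0 xA]] := equivalent_negligible hxi htheta xitheta y.
  by exists A; split => // x /ysectionP; exact: xA.
apply: null_sectionsS (null_sectionsU _ _ (@sub_sigma_algT _ X) (Wtheta q) nxi).
move=> z Wz; have [xtz|] := pselect (prod_fun xi z = prod_fun theta z).
  by left; move: Wz; rewrite !setY_def /= /setD /= xtz.
by right.
Qed.

(** On the null set [N] of parameters where [g] is not a version of [xi y], the
    process keeps its own values: equivalence is required at every [y]. *)
Lemma star_measurable_modification (C : set (set X)) (xi : Y -> X -> R) :
  sub_sigma_alg C -> process PP xi ->
  measurable_wrt (star PP Q C C) (prod_fun xi) ->
  exists theta, measurable_modification PP xi theta.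
Proof.
move=> sC hxi /(star_measurable_version _ _ _ _ _ sC sC)[g mg [N [mN N0 Ng]]].
pose theta y x := if y \in N then xi y x else g (x, y).
have Ntheta y : N y -> theta y = xi y.
  by move=> Ny; apply/funext => x; rewrite /theta mem_set.
have nNtheta y : ~ N y -> theta y = (fun x => g (x, y)).
  by move=> nNy; apply/funext => x; rewrite /theta memNset.
exists theta; split.
- move=> y; have [/Ntheta ->|/nNtheta ->] := pselect (N y); first exact: hxi.
  move=> _ U mU; rewrite setTI; apply: sub_completion.
  rewrite -[X in measurable X]setTI.
  exact: (measurableT_comp mg (measurable_pair2 y)).
- apply: (measurable_eq_off_null N _ g) => //.
    by move=> x y /nNtheta; rewrite /prod_fun /= => ->.
  move=> _ U mU; rewrite setTI; apply: sub_completion.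
  by rewrite -[X in measurable X]setTI; exact: mg.
- move=> y; apply: completed_negligible_eq0.
  have [/Ntheta ->|nNy] := pselect (N y).
    by exists set0; split => // x; rewrite /=.
  have [A [CA A0 gA]] := Ng y nNy; exists A; split => //.
    by case: sC => _; exact.
  by move=> x /= xg; apply/gA/ysectionP => /=; rewrite nNtheta // in xg.
Qed.

(** The section of [pi (prod_fun xi)] at [y] is fixed by [sigma y], so it equals
    [sigma y (xi y)] as soon as it equals [xi y] almost everywhere, which happens
    for almost every [y].  For the remaining [y], equivalence only uses that the
    lifting [sigma y] changes [xi y] on a null set. *)
Lemma lifting_measurable_modification (xi : Y -> X -> R)
    (sigma : Y -> (X -> R) -> X -> R) (pi : (X * Y -> R) -> X * Y -> R) :
  process PP xi -> bounded_process xi ->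
  measurable_wrt (star PP Q measurable measurable) (prod_fun xi) ->
  (forall y, Lambda (completed (PP y)) (sigma y)) ->
  Lambda (Rstar PP) pi ->
  (forall f, Linfty (Rstar PP) f -> Linfty (completed Rm) (pi f)) ->
  (forall f y, Linfty (Rstar PP) f ->
    Linfty (completed (PP y)) (fun x => pi f (x, y)) /\
    (fun x => pi f (x, y)) = sigma y (fun x => pi f (x, y))) ->
  measurable_modification PP xi (fun y => sigma y (xi y)).
Proof.
move=> hxi [M M0 xiM] mxi hsigma hpi mpi sigmapi.
have LXi : Linfty (Rstar PP) (prod_fun xi).
  split; last by exists M => -[x y]; exact: xiM.
  by move=> _ U mU; rewrite setTI; exact: mxi.
have Lxi y : Linfty (completed (PP y)) (xi y).
  by split; [exact: hxi|exists M => x; exact: xiM].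
have [N [mN N0 Npi]] := Rstar_negligible_sections (lifting_ae hpi LXi).
have sigmaE y : ~ N y -> sigma y (xi y) = (fun x => pi (prod_fun xi) (x, y)).
  move=> /Npi[A [mA A0 piA]].
  have [Lpi ->] := sigmapi _ y LXi; apply: (lifting_ae_eq (hsigma y)) => //.
  apply: negligible_completed; exists A; split => // x /= xpi.
  by apply/piA/ysectionP => /= pix; apply: xpi.
split.
- by move=> y; have [] := lifting_Linfty (hsigma y) (Lxi y).
- apply: (measurable_eq_off_null N _ (pi (prod_fun xi))) => //.
    by move=> x y /sigmaE; rewrite /prod_fun /= => ->.
  by have [] := mpi _ LXi.
- move=> y; apply: completed_negligible_eq0; apply: completed_negligible.
  apply: negligibleS (lifting_ae (hsigma y) (Lxi y)) => x /= xs sx.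
  exact: xs.
Qed.

End skew_product.

Theorem theorem2p1 (R : realType) (dX dY : measure_display)
    (X : measurableType dX) (Y : measurableType dY)
    (P : probability X R) (Q : probability Y R)
    (Rm : probability (X * Y)%type R) (PP : rcp P Q Rm)
    (xi : Y -> X -> R) (hxi : process PP xi) :
  [/\ ((exists theta, measurable_modification PP xi theta) ->
        exists C : set (set X),
          [/\ sub_sigma_alg C, countably_generated C &
              measurable_wrt (star PP Q C measurable) (prod_fun xi)]),
      ((exists C : set (set X),
          [/\ sub_sigma_alg C, FN_separable P C &
              measurable_wrt (star PP Q C C) (prod_fun xi)]) ->
        exists theta, measurable_modification PP xi theta) &
      bounded_process xi ->
      (exists C : set (set X),
        [/\ sub_sigma_alg C, countably_generated C & FN_dense P C measurable]) ->
      measurable_wrt (star PP Q measurable measurable) (prod_fun xi) ->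
      forall (sigma : Y -> (X -> R) -> X -> R)
             (pi : (X * Y -> R) -> X * Y -> R),
        (forall y, Lambda (completed (PP y)) (sigma y)) ->
        Lambda (Rstar PP) pi ->
        (forall f, Linfty (Rstar PP) f -> Linfty (completed Rm) (pi f)) ->
        (forall f y, Linfty (Rstar PP) f ->
          Linfty (completed (PP y)) (fun x => pi f (x, y)) /\
          (fun x => pi f (x, y)) = sigma y (fun x => pi f (x, y))) ->
        measurable_modification PP xi (fun y => sigma y (xi y))].
Proof.
split.
- by move=> [theta]; exact: measurable_modification_star.
- by move=> [C [sC _ mxi]]; exact: star_measurable_modification mxi.
- by move=> bxi _ mxi sigma pi; exact: lifting_measurable_modification.
Qed.
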